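(* Let $q$ be a prime power, $2\le n\le m$ integers, $\mathcal{C}\le\mathbb{F}_q^{n\times m}$ a rank-metric code of dimension $k$ over $\mathbb{F}_q$, and $0\le i\le k$. If $\mathcal{C}$ is $i$-BMD, then $\mathcal{C}$ is $i$-MRD.
   Context: A rank-metric code is an $\mathbb{F}_q$-linear subspace $\mathcal{C}\le \mathbb{F}_q^{n\times m}$; its dual is $\mathcal{C}^\perp=\{N\in\mathbb{F}_q^{n\times m}:\operatorname{Tr}(MN^t)=0 \text{ for all } M\in\mathcal{C}\}$. The minimum distance of a nonzero code is the minimum rank of a nonzero element; the minimum distance of $\{0\}$ is defined to be $n+1$. Let $d^\perp$ denote the minimum distance of $\mathcal{C}^\perp$. An optimal anticode is a subspace $A\le\mathbb{F}_q^{n\times m}$ with $\dim_{\mathbb{F}_q}(A)=m\cdot\max\{\operatorname{rk}(M):M\in A\}$. For $0\le i\le k$ the $i$-th generalized rank weight is $d_i=d_i(\mathcal{C})=\frac1m\min\{\dim_{\mathbb{F}_q}(A): A \text{ an optimal anticode},\ \dim_{\mathbb{F}_q}(A\cap\mathcal{C})\ge i\}$. $\mathcal{C}$ is $i$-BMD if $n-d^\perp-d_i<0$. $\mathcal{C}$ is $i$-MRD if $d_i=n-\left\lfloor\frac{k-i}{m}\right\rfloor$. *)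

(* Defs.v *)
From HB Require Import structures.
From mathcomp Require Export all_boot all_order all_algebra.

Set Implicit Arguments.
Unset Strict Implicit.
Unset Printing Implicit Defensive.

Import Order.TTheory GRing.Theory Num.Theory.
Local Open Scope ring_scope.

(* Subspaces over a finite field form a finite type, so that one can take a
   minimum over them. *)
HB.instance Definition _ (F : finFieldType) (vT : vectType F) :
    isCountable {vspace vT} :=
  CanIsCountable (@VectorInternalTheory.vs2mxK F vT).
HB.instance Definition _ (F : finFieldType) (vT : vectType F) :
    isFinite {vspace vT} :=
  CanIsFinite (@VectorInternalTheory.vs2mxK F vT).

Section RankMetricCodes.

Variables (F : finFieldType) (n m : nat).
Implicit Types (C A : {vspace 'M[F]_(n, m)}) (M N : 'M[F]_(n, m)).

(* The span is that of a set which is already a subspace, see [mem_dual_code]. *)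
Definition dual_code C : {vspace 'M[F]_(n, m)} :=
  <<enum [pred N | [forall M in C, (\tr (M *m N^T) == 0)%R]]>>%VS.

Lemma mem_dual_code C N :
  reflect (forall M, M \in C -> \tr (M *m N^T) = 0) (N \in dual_code C).
Proof.
rewrite /dual_code; set s := enum _.
have in_s N' : (N' \in s) = [forall M in C, \tr (M *m N'^T) == 0]
  by rewrite mem_enum.
apply: (iffP idP) => [/(@coord_span _ _ _ (in_tuple s)) -> M MC | NC]; last first.
  by apply: memv_span; rewrite in_s; apply/forall_inP => M /NC ->.
rewrite linear_sum mulmx_sumr raddf_sum big1 //= => i _.
rewrite linearZ /= -scalemxAr linearZ /=.
have : s`_i \in s by rewrite mem_nth.
by rewrite in_s => /forall_inP/(_ _ MC)/eqP ->; rewrite mulr0.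
Qed.

(* Ranks are at most n, so the neutral value n + 1 is returned exactly when
   C = 0. *)
Definition min_distance C : nat :=
  \big[minn/n.+1]_(M in C | M != 0) \rank M.

Definition max_rank A : nat := (\max_(M in A) \rank M)%N.

Definition optimal_anticode A : bool := \dim A == (m * max_rank A)%N.

(* The whole space is an admissible anticode when n <= m and i <= \dim C (see
   [gen_rank_weightP]); outside this range the minimum may be over no A.  The
   division is exact, since m divides the dimension of an optimal anticode. *)
Definition gen_rank_weight C (i : nat) : nat :=
  (\dim [arg min_(A < {:'M[F]_(n, m)}%VS |
              optimal_anticode A && (i <= \dim (A :&: C))) \dim A] %/ m)%N.

Lemma optimal_anticode_full : (n <= m)%N -> optimal_anticode fullv.
Proof.
move=> le_nm; rewrite /optimal_anticode dimvf /dim /= mulnC eqn_mul2l.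
apply/orP; right; rewrite eqn_leq; apply/andP; split; last first.
  by apply/bigmax_leqP => M _; apply: rank_leq_row.
apply: (@leq_trans (\rank (pid_mx n : 'M[F]_(n, m)))).
  by rewrite rank_pid_mx.
by apply: leq_bigmax_cond; rewrite memvf.
Qed.

Lemma gen_rank_weightP C i : (n <= m)%N -> (i <= \dim C)%N ->
  (exists A, [/\ optimal_anticode A, (i <= \dim (A :&: C))%N
               & \dim A = (m * gen_rank_weight C i)%N])
  /\ (forall A, optimal_anticode A -> (i <= \dim (A :&: C))%N ->
        (m * gen_rank_weight C i <= \dim A)%N).
Proof.
move=> le_nm le_iC; rewrite /gen_rank_weight; case: arg_minnP => /= [|A].
  by rewrite optimal_anticode_full // capfv.
move=> /andP[oA iA] minA.
have dA : (m * (\dim A %/ m))%N = \dim A.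
  by rewrite mulnC divnK // (eqP oA) dvdn_mulr.
split; first by exists A; rewrite dA.
by move=> B oB iB; rewrite dA minA ?oB.
Qed.

Lemma min_distance0 : min_distance 0%VS = n.+1.
Proof.
by rewrite /min_distance big_pred0 // => M; rewrite memv0; case: eqP.
Qed.

Lemma min_distanceP C : C != 0%VS ->
  (exists M, [/\ M \in C, M != 0 & \rank M = min_distance C])
  /\ (forall M, M \in C -> M != 0 -> (min_distance C <= \rank M)%N).
Proof.
move=> nzC; pose P M := (M \in C) && (M != 0).
have P0 : P (vpick C) by rewrite /P memv_pick vpick0.
have lb M : P M -> (min_distance C <= \rank M)%N.
  move=> PM; rewrite /min_distance; have := mem_index_enum M.
  elim: (index_enum _) => // N s IHs; rewrite inE big_cons.
  case/predU1P=> [<-|/IHs sM].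
    by rewrite -/(P M) PM geq_minl.
  by case: ifP => // _; rewrite geq_min sM orbT.
split; last by move=> M MC M0; apply: lb; rewrite /P MC.
case: (arg_minnP (fun M => \rank M) P0) => M PM minM; exists M.
have /andP[MC M0] := PM; split=> //; apply/eqP; rewrite eqn_leq lb // andbT.
rewrite /min_distance; apply: (big_ind (fun r => (\rank M <= r)%N)) => //.
  exact/leqW/rank_leq_row.
by move=> x y hx hy; rewrite leq_min hx.
Qed.

(* The differences are taken in int: they are signed in the first definition. *)
Definition BMD (i : nat) C : Prop :=
  n%:Z - (min_distance (dual_code C))%:Z - (gen_rank_weight C i)%:Z < 0.

Definition MRD (i : nat) C : Prop :=
  (gen_rank_weight C i)%:Z = n%:Z - ((\dim C - i) %/ m)%N%:Z.

End RankMetricCodes.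

(* Main.v *)
From HB Require Import structures.
Require Import Defs.
From mathcomp Require Import zify.
From mathcomp Require Import all_fingroup all_solvable all_field.

Import Order.TTheory GRing.Theory Num.Theory VectorInternalTheory.
Set Implicit Arguments.
Unset Strict Implicit.
Unset Printing Implicit Defensive.
Local Open Scope ring_scope.

(** The point is that an optimal anticode A with maximal rank r is orthogonal to
    no matrix N of rank greater than n - r.  Were it, the maximum rank distance
    code E of linearized polynomials over an extension of degree m, of dimension
    m (n - r) and with all nonzero ranks greater than r, could be chosen
    orthogonal to N as well: then A and E would be complementary, and N
    orthogonal to everything.  For an i-BMD code C and an optimal anticode A
    realizing d_i, it follows that no nonzero matrix is orthogonal to both A and
    C, so A + C is the whole space and dim (A :&: C) = m d_i + k - n m is at
    least i; this is the converse of the Singleton bound. *)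

(** * Extensions of a finite field *)

(** In the splitting field [L] of ['X^N - 'X], where [N] is the [d]-th power of [#|F|], the roots
    are distinct and form a subfield, hence fill [L]; counting elements gives the dimension. *)
Lemma exists_extension_of_degree (F : finFieldType) (d : nat) :
  (0 < d)%N -> exists L : splittingFieldType F, \dim {:L} = d.
Proof.
move=> d_gt0; have q_gt1 : (1 < #|F|)%N := finNzRing_gt1 F.
pose N := (#|F| ^ d)%N; have N_gt1 : (1 < N)%N by rewrite (ltn_exp2l 0).
pose P (R : nzRingType) : {poly R} := 'X^N - 'X.
have szP (R : nzRingType) : size (P R) = N.+1.
  by rewrite size_polyDl size_polyXn // size_polyN size_polyX.
have /FinSplittingFieldFor[L [zs]] : P F != 0 by rewrite -size_poly_eq0 szP.
rewrite [map_poly _ _]rmorphB rmorphXn /= map_polyX -/(P L) => DPL defL.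
exists L.
have /finField_galois_generator[/= a _ Da] : (1 <= {:L})%VS by apply: sub1v.
rewrite /= dimv1 expn1 in Da.
have N0 : N%:R = 0 :> L.
  have q0 : #|F|%:R = 0 :> F.
    by rewrite -FinRing.zmodXgE -cardsT expg_cardG ?inE.
  by rewrite natrX -[#|F|%:R](rmorph_nat (in_alg L)) q0 rmorph0 expr0n gtn_eqF.
(* Separability: [N] vanishes in [L], so the derivative of ['X^N - 'X] is -1. *)
have Uzs : uniq zs.
  rewrite -separable_prod_XsubC -(eqp_separable DPL).
  rewrite unlock derivB derivXn derivX.
  by rewrite -scaler_nat N0 scale0r sub0r -scaleN1r coprimepZr ?oppr_eq0 ?oner_eq0 ?coprimep1.
(* As [a] is the Frobenius map over [F], the roots are the fixed points of its [d]-th power. *)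
pose E := fixedSpace (a ^+ d)%g.
have in_zs : zs =i E.
  move=> z; rewrite -root_prod_XsubC -(eqp_root DPL) (sameP fixedSpaceP eqP).
  rewrite /root !hornerE subr_eq0 /N; congr (_ == z).
  elim: (d) => [|i IHi]; first by rewrite gal_id.
  by rewrite expgSr expnSr exprM IHi galM ?Da ?memvf.
have fixT : E = {:L}%VS.
  apply/eqP; rewrite eqEsubv subvf -defL -[E]subfield_closed agenvS //.
  by rewrite subv_add sub1v; apply/span_subvP=> z; rewrite in_zs.
have cardL : #|finvect_type L| = N.
  have /eq_card -> : finvect_type L =i zs by move=> z; rewrite in_zs fixT memvf.
  apply: succn_inj; rewrite (card_uniqP _) //= -(size_prod_XsubC _ id).
  by rewrite -(eqp_size DPL) szP.
pose cL := Vector.class (finvect_type L).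
by apply/eqP; rewrite -(eqn_exp2l _ _ q_gt1) -(@card_vspace F _ cL) (@card_vspacef F _ cL) cardL.
Qed.

(** * Linearized polynomials and maximum rank distance codes *)

Section LinearizedPolynomials.
Variables (F : finFieldType) (L : splittingFieldType F).
Local Notation q := #|F|.
Implicit Types (x y : L).

(** This map is the [l]-th power of a Galois automorphism over [F]. *)
Lemma expr_card_linear l : linear (fun x : L => x ^+ (q ^ l)).
Proof.
have /finField_galois_generator[/= a _ Da] : (1 <= {:L})%VS by apply: sub1v.
rewrite /= dimv1 expn1 in Da.
suff E x : x ^+ (q ^ l) = (a ^+ l)%g x by move=> c x y; rewrite !E linearP.
elim: l x => [|l IHl] x; first by rewrite gal_id.
by rewrite expgSr expnSr exprM IHl galM ?Da ?memvf.
Qed.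

Definition linpoly t (c : {ffun 'I_t -> L}) x := \sum_(l < t) c l * x ^+ (q ^ l).

Lemma linpoly_linear t (c : {ffun 'I_t -> L}) : linear (linpoly c).
Proof.
move=> a x y; rewrite /linpoly scaler_sumr -big_split /=; apply: eq_bigr => l _.
by rewrite expr_card_linear mulrDr scalerAr.
Qed.
HB.instance Definition _ t (c : {ffun 'I_t -> L}) :=
  GRing.isLinear.Build F L L *:%R (linpoly c) (linpoly_linear c).

Definition linpoly_mx t (c : {ffun 'I_t -> L}) : 'M[F]_(dim L) :=
  lin1_mx (v2r \o linpoly c \o r2v).

Lemma linpoly_mxE t (c : {ffun 'I_t -> L}) u :
  u *m linpoly_mx c = v2r (linpoly c (r2v u)).
Proof. by rewrite mul_rV_lin1. Qed.

Lemma linpoly_mx_linear t : linear (@linpoly_mx t).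
Proof.
move=> a c c'; apply/row_matrixP => i; rewrite !rowE mulmxDr -scalemxAr.
rewrite !linpoly_mxE -linearP; congr v2r.
rewrite /linpoly scaler_sumr -big_split /=; apply: eq_bigr => l _.
by rewrite !ffunE mulrDl scalerAl.
Qed.
HB.instance Definition _ t :=
  GRing.isLinear.Build F _ _ _ (@linpoly_mx t) (@linpoly_mx_linear t).

(* A polynomial of q-degree less than t has at most q^(t-1) roots. *)
Lemma rank_linpoly_mx t (c : {ffun 'I_t -> L}) :
  c != 0 -> (dim L < \rank (linpoly_mx c) + t)%N.
Proof.
have q_gt1 : (1 < q)%N := finNzRing_gt1 F.
case: t c => [c /eqP[]|t c c_neq0]; first by apply/ffunP => -[].
pose p : {poly L} := \sum_(l < t.+1) c l *: 'X^(q ^ l).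
have p_x x : p.[x] = linpoly c x.
  by rewrite horner_sum; apply: eq_bigr => l _; rewrite hornerZ hornerXn.
have p_l (l : 'I_t.+1) : p`_(q ^ l) = c l.
  rewrite coef_sum (bigD1 l) //= coefZ coefXn eqxx mulr1 big1 ?addr0 // => j jl.
  by rewrite coefZ coefXn eqn_exp2l // eq_sym (inj_eq val_inj) (negPf jl) mulr0.
have p_neq0 : p != 0.
  apply: contraNneq c_neq0 => p0; apply/eqP/ffunP => l.
  by rewrite -p_l p0 coef0 ffunE.
have size_p : (size p <= (q ^ t).+1)%N.
  apply/(leq_trans (size_sum _ _ _))/bigmax_leqP => l _.
  by rewrite (leq_trans (size_scale_leq _ _)) // size_polyXn ltnS leq_exp2l // -ltnS.
pose K := kermx (linpoly_mx c); pose k := \rank K.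
pose g (u : 'rV[F]_k) := r2v (u *m row_base K).
have g_inj : injective g by move=> u v /r2v_inj /(row_free_inj (row_base_free K)).
(* A kernel of dimension [k] yields [q ^ k] distinct roots of [p], whose degree is at most
   [q ^ t]. *)
pose rs := [seq g u | u : 'rV[F]_k].
have rs_root : all (root p) rs.
  apply/allP => _ /mapP[u _ ->]; rewrite rootE p_x.
  apply/eqP/v2r_inj; rewrite linear0 -linpoly_mxE; apply: sub_kermxP.
  by rewrite mulmx_sub // eq_row_base.
have rs_uniq : uniq rs by rewrite map_inj_uniq ?enum_uniq.
have := leq_trans (max_poly_roots p_neq0 rs_root rs_uniq) size_p.
rewrite size_map -cardE card_mx mul1n ltnS leq_exp2l // /k mxrank_ker.
by rewrite leq_subLR addnS ltnS addnC.
Qed.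


Lemma exists_kermx_neq0 (K : fieldType) (p k : nat) (M : 'M[K]_(p, k)) :
  (\rank M < p)%N -> exists2 v : 'rV[K]_p, v != 0 & v *m M = 0.
Proof.
move=> ltMp; exists (nz_row (kermx M)).
  by rewrite nz_row_eq0 kermx_eq0 /row_free neq_ltn ltMp.
exact/sub_kermxP/nz_row_sub.
Qed.

Lemma mxrank_equiv (K : fieldType) (p k : nat) (M N : 'M[K]_(p, k)) :
  \rank M = \rank N ->
  exists X Y, [/\ X \in unitmx, Y \in unitmx & N = X *m M *m Y].
Proof.
move=> rMN.
exists (col_ebase N *m invmx (col_ebase M)), (invmx (row_ebase M) *m row_ebase N).
rewrite !unitmx_mul !unitmx_inv !row_ebase_unit !col_ebase_unit; split=> //.
rewrite -{2}(mulmx_ebase M) !mulmxA mulmxKV ?col_ebase_unit //.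
by rewrite mulmxK ?row_ebase_unit // rMN mulmx_ebase.
Qed.

(** Row [j] of [B] represents the functional sending [y] to [T (b j * y)], for one fixed nonzero
    functional [T]. As [L] is a field, the form [T (x * y)] is nondegenerate, so a relation between
    the rows of [B] is one between the entries of [b]. The trace is [T] applied to the [L]-valued
    sum. *)
Lemma row_free_dual_coords s (b : 'I_s -> L) :
  (forall u : 'rV[F]_s, \sum_j u 0 j *: b j = 0 -> u = 0) ->
  exists2 B : 'M[F]_(s, dim L), row_free B
    & forall Y : 'M[F]_(s, dim L), \sum_j b j * r2v (row j Y) = 0 ->
        \tr (Y *m B^T) = 0.
Proof.
move=> b_free; have dimL_gt0 : (0 < dim L)%N.
  by rewrite -dimvf (leq_trans _ (dimvS (subvf 1%VS))) ?dimv1.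
pose T x := v2r x 0 (Ordinal dimL_gt0).
have T_lin : scalar T by move=> a x y; rewrite /T linearP !mxE.
pose e c : L := r2v (delta_mx 0 c).
have TE x (y : 'rV_(dim L)) : T (x * r2v y) = \sum_c y 0 c * T (x * e c).
  rewrite {1}(row_sum_delta y) linear_sum mulr_sumr /T linear_sum summxE.
  by apply: eq_bigr => c _; rewrite linearZ -scalerAr linearZ mxE.
exists (\matrix_(j, c) T (b j * e c)) => [|Y bY].
  apply: inj_row_free => u uB0; apply: b_free; set x := \sum_j _.
  apply: contra_eq uB0 => x_neq0.
  (* The second factor is chosen so that the product is the basis vector on which [T] is 1. *)
  have : T (x * r2v (v2r (x^-1 * r2v (delta_mx 0 (Ordinal dimL_gt0))))) = 1.
    by rewrite v2rK mulVKf // /T r2vK mxE !eqxx.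
  rewrite TE => sum1; apply/eqP => uB0; move/eqP: sum1; apply/negP.
  rewrite big1 ?[0 == _]eq_sym ?oner_eq0 // => c _.
  have /rowP/(_ c) := uB0; rewrite !mxE => uc.
  rewrite [T _](_ : _ = 0) ?mulr0 // -uc /x mulr_suml /T linear_sum summxE.
  by apply: eq_bigr => j _; rewrite !mxE -scalerAl linearZ mxE.
transitivity (T (\sum_j b j * r2v (row j Y))); last by rewrite bY /T linear0 mxE.
rewrite /T linear_sum summxE /mxtrace; apply: eq_bigr => j _.
rewrite -/(T _) TE mxE; apply: eq_bigr => c _; by rewrite !mxE.
Qed.

(* With b spanning the left kernel of the Moore matrix M of the rows of A, a
   relation u between the entries of b makes [M | u] singular, so some linearized
   polynomial of q-degree less than s takes values in a line on the rows of A. *)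
Lemma moore_kernel_free s (A : 'M[F]_(s.+1, dim L)) : row_free A ->
  exists2 b : 'I_s.+1 -> L,
    forall l, (l < s)%N -> \sum_j b j * r2v (row j A) ^+ (q ^ l) = 0
    & forall u : 'rV[F]_s.+1, \sum_j u 0 j *: b j = 0 -> u = 0.
Proof.
move=> A_free; pose M : 'M[L]_(s.+1, s) := \matrix_(j, l) r2v (row j A) ^+ (q ^ l).
have [v v_neq0 vM0] : exists2 v : 'rV_s.+1, v != 0 & v *m M = 0.
  by apply: exists_kermx_neq0; rewrite ltnS rank_leq_col.
exists (v 0) => [l lt_ls|u uv0].
  have /rowP/(_ (Ordinal lt_ls)) := vM0; rewrite !mxE => vM; rewrite -[RHS]vM.
  by apply: eq_bigr => j _; rewrite mxE.
pose w := map_mx (in_alg L) u; pose M' := row_mx M w^T.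
have vM'0 : v *m M' = 0.
  rewrite mul_mx_row vM0; apply/eqP; rewrite row_mx_eq0 eqxx; apply/eqP/rowP => k.
  rewrite !mxE -[RHS]uv0; apply: eq_bigr => j _.
  by rewrite !mxE mulrC mulr_algl ord1.
(* [M'] is square and [v] kills it on the left, so some nonzero column is killed on the right: the
   coefficients [f] followed by [z]. *)
have [c c_neq0 cM'0] : exists2 c : 'rV_(s + 1), c != 0 & c *m M'^T = 0.
  apply: exists_kermx_neq0; rewrite mxrank_tr [X in (_ < X)%N]addn1.
  rewrite ltn_neqAle rank_leq_row andbT; apply: contra_neqN v_neq0 => rM'.
  by apply: (row_free_inj (A := M')); rewrite ?mul0mx.
pose f := [ffun l => lsubmx c 0 l]; pose z := c 0 (rshift s ord0).
have fA : A *m linpoly_mx f = u^T *m v2r (- z).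
  apply/row_matrixP => j; rewrite row_mul linpoly_mxE row_mul.
  have /rowP/(_ j) := cM'0; rewrite -(hsubmxK c) tr_row_mx mul_row_col trmxK.
  rewrite !mxE big_ord1 !mxE /= => fj.
  rewrite [row j u^T](_ : _ = (u 0 j)%:M); last by apply/rowP => i; rewrite !mxE ord1 mulr1n.
  rewrite mul_scalar_mx -linearZ scalerN; congr v2r; apply/eqP.
  rewrite -addr_eq0 -[X in _ == X]fj; apply/eqP; congr (_ + _).
    by apply: eq_bigr => l _; rewrite !mxE ffunE mxE.
  by rewrite -mulr_algr ord1.
(* Otherwise the matrix of [f] has corank less than [s], so its product with [A], of rank [s.+1],
   has rank at least 2; but [fA] bounds that rank by 1. *)
have f0 : f = 0.
  apply/eqP/contraT => /rank_linpoly_mx; rewrite ltnNge => /negP[].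
  have := mxrank_mul_min A (linpoly_mx f); rewrite fA (eqnP A_free).
  have le1 := leq_trans (mxrankM_maxr u^T (v2r (- z))) (rank_leq_row _).
  by move/leq_trans/(_ le1); rewrite leq_subLR addn1 addSn ltnS addnC.
have z_neq0 : z != 0.
  apply: contraNneq c_neq0 => z0; rewrite -(hsubmxK c) row_mx_eq0; apply/andP; split.
    by apply/eqP/rowP => l; have /ffunP/(_ l) := f0; rewrite !ffunE => ->; rewrite mxE.
  by apply/eqP/rowP => l; rewrite ord1 mxE -/z z0 mxE.
apply/rowP => j; move/row_matrixP/(_ j): fA; rewrite f0 linear0 mulmx0 row0 row_mul.
rewrite [row j u^T](_ : _ = (u 0 j)%:M); last by apply/rowP => i; rewrite !mxE ord1 mulr1n.
rewrite mul_scalar_mx => /esym/eqP; rewrite scaler_eq0 mxE => /predU1P[//|/eqP vz0].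
by case/eqP: z_neq0; apply/oppr_inj/v2r_inj; rewrite vz0 oppr0 linear0.
Qed.

(** A Gabidulin code, evaluating linearized polynomials with [t] coefficients at [n] independent
    points, is orthogonal to a particular [N0] of the same rank as [N], built from a Moore kernel.
    Invertible changes of rows and columns carry [N0] to [N], and the code is moved accordingly. *)
Lemma exists_MRD_orthogonal n t (N : 'M[F]_(n, dim L)) :
  (n <= dim L)%N -> (t <= n)%N -> (t < \rank N)%N ->
  exists E : {vspace 'M[F]_(n, dim L)},
    [/\ \dim E = (dim L * t)%N,
        forall M, M \in E -> M != 0 -> (n - t < \rank M)%N
      & forall M, M \in E -> \tr (M *m N^T) = 0].
Proof.
move=> le_nm le_tn; case def_s: (\rank N) => [//|s] lt_ts.
have le_sn : (s.+1 <= n)%N by rewrite -def_s rank_leq_row.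
pose A : 'M[F]_(s.+1, dim L) := pid_mx s.+1.
have A_free : row_free A by rewrite /row_free rank_pid_mx // (leq_trans le_sn).
have [b bA b_free] := moore_kernel_free A_free.
have [B B_free bB] := row_free_dual_coords b_free.
pose N0 := (pid_mx s.+1 : 'M[F]_(n, s.+1)) *m B.
have [X [Y [X_unit Y_unit NE]]] : exists X Y,
    [/\ X \in unitmx, Y \in unitmx & N = X *m N0 *m Y].
  by apply: mxrank_equiv; rewrite def_s mxrankMfree // rank_pid_mx.
(* The inverse transposes cancel [X] and [Y] in the trace against [N^T]. Keeping only [n] rows
   lowers the rank by at most [dim L - n]. *)
pose h := mulmxr (invmx Y^T) \o mulmx (invmx X^T *m pid_mx n) \o @linpoly_mx t.
have hE c : linfun h c = invmx X^T *m pid_mx n *m linpoly_mx c *m invmx Y^T.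
  by rewrite lfunE.
have rank_h c : c != 0 -> (n - t < \rank (linfun h c))%N.
  move=> /rank_linpoly_mx; rewrite hE mxrankMfree; last first.
    by rewrite row_free_unit unitmx_inv unitmx_tr.
  rewrite -!mulmxA eqmxMfull; last by rewrite row_full_unit unitmx_inv unitmx_tr.
  have := mxrank_mul_min (pid_mx n : 'M[F]_(n, dim L)) (linpoly_mx c).
  rewrite rank_pid_mx //; set r := \rank (linpoly_mx c); set r' := \rank _.
  rewrite leq_subLR => h1 h2; rewrite ltn_subLR // -(ltn_add2l (dim L)).
  by move: (dim L) r r' h1 h2 => d r r' h1 h2; lia.
exists (limg (linfun h)); split=> [|M /memv_imgP[c _ ->] hc_neq0|M /memv_imgP[c _ ->]].
- have := limg_ker_dim (linfun h) fullv; rewrite capfv.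
  rewrite (_ : lker _ = 0%VS) ?dimv0 ?add0n => [->|]; last first.
    apply/eqP; rewrite -subv0; apply/subvP => c; rewrite memv_ker memv0.
    by apply: contraLR => /rank_h; rewrite -mxrank_eq0; case: (\rank _).
  by rewrite dimvf /dim /= card_ord mulnC.
- by apply: rank_h; apply: contraNneq hc_neq0 => ->; rewrite linear0.
rewrite hE NE !trmx_mul !mulmxA mulmxKV ?unitmx_tr // mxtrace_mulC !mulmxA.
rewrite mulmxV ?unitmx_tr // mul1mx mxtrace_mulC !mulmxA tr_pid_mx.
rewrite mul_pid_mx (minn_idPl le_sn) (minn_idPr le_sn) -/A; apply: bB.
(* Once the sums are exchanged, each [l] contributes a Moore relation, available because
   [l < t <= s]. *)
transitivity (\sum_j \sum_(l < t) c l * (b j * r2v (row j A) ^+ (q ^ l))).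
  apply: eq_bigr => j _; rewrite row_mul linpoly_mxE v2rK mulr_sumr.
  by apply: eq_bigr => l _; rewrite mulrCA.
rewrite exchange_big big1 //= => l _; rewrite -mulr_sumr bA ?mulr0 //.
by rewrite (leq_trans (ltn_ord l)).
Qed.

End LinearizedPolynomials.

(** * Trace duality and optimal anticodes *)

Section RankMetric.
Variables (F : finFieldType) (n : nat).

Lemma dimv_fullmx m : \dim {:'M[F]_(n, m)} = (n * m)%N.
Proof. by rewrite dimvf dim_matrix. Qed.

Lemma trmx_form_nondegenerate m (N : 'M[F]_(n, m)) :
  (forall M : 'M[F]_(n, m), \tr (M *m N^T) = 0) -> N = 0.
Proof.
move=> N0; apply/matrixP => i j; rewrite [RHS]mxE -(N0 (delta_mx i j)).
rewrite /mxtrace (bigD1 i) //= mxE (bigD1 j) //= !mxE !eqxx mul1r.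
rewrite !big1 ?addr0 // => k; last by rewrite mxE => /negPf->; rewrite andbF mul0r.
by move=> /negPf ki; rewrite mxE big1 // => l _; rewrite mxE ki mul0r.
Qed.

(** Orthogonality to a basis of [D] imposes [\dim D] linear conditions, fewer than the dimension of
    the matrix space. *)
Lemma exists_orthogonal_mx m (D : {vspace 'M[F]_(n, m)}) : D != fullv ->
  exists2 N : 'M[F]_(n, m), N != 0 & forall M, M \in D -> \tr (M *m N^T) = 0.
Proof.
move=> D_proper; pose phi N := \row_k \tr ((vbasis D)`_k *m N^T) : 'rV[F]_(\dim D).
have phi_lin : linear phi.
  by move=> a N N'; apply/rowP => k; rewrite !mxE linearP mulmxDr -scalemxAr linearP.
pose phiL := GRing.isLinear.Build F _ _ *:%R phi phi_lin.
pose Phi : {linear _ -> _} := HB.pack phi phiL.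
have ltD : (\dim D < \dim {:'M[F]_(n, m)})%N.
  by rewrite ltn_neqAle dimvS ?subvf // andbT (dimv_leqif_eq (subvf D)).2.
have kerN0 : lker (linfun Phi) != 0%VS.
  apply: contraTneq ltD => ker0; have := limg_ker_dim (linfun Phi) fullv.
  rewrite capfv ker0 dimv0 add0n -leqNgt => <-.
  by rewrite (leq_trans (dimvS (subvf _))) // dimvf /dim /= mul1n.
exists (vpick (lker (linfun Phi))); first by rewrite vpick0.
have := memv_pick (lker (linfun Phi)); set N := vpick _.
rewrite memv_ker lfunE /= => /eqP/rowP N0 M /coord_vbasis ->.
rewrite mulmx_suml linear_sum big1 // => k _.
by rewrite -scalemxAl linearZ /=; have := N0 k; rewrite !mxE => ->; rewrite mulr0.
Qed.

Lemma rank_orthogonal_anticode m (A : {vspace 'M[F]_(n, m)}) (N : 'M[F]_(n, m)) :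
  (0 < m)%N -> (n <= m)%N -> optimal_anticode A ->
  (forall M, M \in A -> \tr (M *m N^T) = 0) -> (max_rank A + \rank N <= n)%N.
Proof.
move=> m_gt0 le_nm /eqP dimA AN; set r := max_rank A.
have le_rn : (r <= n)%N by apply/bigmax_leqP => M _; apply: rank_leq_row.
rewrite -leq_subRL // leqNgt; apply/negP => lt_N.
have [E [dimE rankE EN]] : exists E : {vspace 'M[F]_(n, m)},
    [/\ \dim E = (m * (n - r))%N,
        forall M, M \in E -> M != 0 -> (r < \rank M)%N
      & forall M, M \in E -> \tr (M *m N^T) = 0].
  (* With [t = n - r], nonzero codewords have rank above [n - t = r]. *)
  have [L] := exists_extension_of_degree F m_gt0; rewrite dimvf => dimL.
  subst m; have := exists_MRD_orthogonal le_nm (leq_subr r n) lt_N.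
  by rewrite subKn.
have capAE : (A :&: E = 0)%VS.
  apply/eqP; rewrite -subv0; apply/subvP => M; rewrite memv_cap memv0 => /andP[MA ME].
  apply: contraT => /(rankE _ ME); rewrite ltnNge => /negP[].
  by rewrite /r /max_rank; apply: leq_bigmax_cond.
have sumAE : (A + E)%VS = fullv.
  apply/eqP; rewrite -(dimv_leqif_eq (subvf _)).2 dimv_disjoint_sum // dimE dimA.
  by rewrite -mulnDr subnKC // dimvf dim_matrix mulnC.
suff N0 : N = 0 by rewrite N0 mxrank0 in lt_N.
apply: trmx_form_nondegenerate => M.
have : M \in (A + E)%VS by rewrite sumAE memvf.
case/memv_addP => M1 /AN M1N [M2 /EN M2N ->].
by rewrite mulmxDl mxtraceD M1N M2N addr0.
Qed.

(** The matrices supported on the first [u] rows form such an anticode. *)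
Lemma exists_optimal_anticode m u : (u <= n)%N -> (n <= m)%N ->
  exists2 A : {vspace 'M[F]_(n, m)}, optimal_anticode A & \dim A = (m * u)%N.
Proof.
move=> le_un le_nm; have le_um := leq_trans le_un le_nm.
pose P : 'M[F]_(n, u) := pid_mx u; pose f := linfun (mulmx P : 'M_(u, m) -> _).
have P_free X : \rank (P *m X) = \rank X :> nat.
  by rewrite eqmxMfull // /row_full rank_pid_mx.
have dimA : \dim (limg f) = (m * u)%N.
  have := limg_ker_dim f fullv; rewrite capfv (_ : lker f = 0%VS); last first.
    apply/eqP; rewrite -subv0; apply/subvP => X; rewrite memv_ker memv0 lfunE /=.
    by rewrite -!mxrank_eq0 P_free.
  by rewrite dimv0 add0n => ->; rewrite dimvf dim_matrix mulnC.
exists (limg f); rewrite // /optimal_anticode dimA; apply/eqP; congr (_ * _)%N.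
apply/eqP; rewrite eqn_leq; apply/andP; split; last first.
  by apply/bigmax_leqP => _ /memv_imgP[X _ ->]; rewrite lfunE P_free rank_leq_row.
rewrite -[X in (X <= _)%N](_ : \rank (f (pid_mx u)) = u); last first.
  by rewrite lfunE P_free rank_pid_mx.
by apply: leq_bigmax_cond; rewrite memv_img ?memvf.
Qed.

(** An optimal anticode of codimension [m * ((\dim C - i) %/ m)], hence at most [\dim C - i], meets
    [C] in dimension at least [i]. *)
Lemma gen_rank_weight_Singleton m (C : {vspace 'M[F]_(n, m)}) i :
  (0 < m)%N -> (n <= m)%N -> (i <= \dim C)%N ->
  (gen_rank_weight C i <= n - (\dim C - i) %/ m)%N.
Proof.
move=> m_gt0 le_nm le_iC.
have [A oA dimA] := exists_optimal_anticode (leq_subr ((\dim C - i) %/ m) n) le_nm.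
rewrite -(leq_pmul2l m_gt0) -dimA; apply: (gen_rank_weightP le_nm le_iC).2 => //.
have leC : (\dim C <= n * m)%N by rewrite -(dimv_fullmx m) dimvS ?subvf.
have sumAC : (\dim (A + C) <= n * m)%N by rewrite -(dimv_fullmx m) dimvS ?subvf.
have := dimv_sum_cap A C; have := leq_divM (\dim C - i) m; rewrite dimA mulnBr.
move: (\dim C) (\dim (A + C)) (\dim (A :&: C)) leC sumAC le_iC => k a b; nia.
Qed.

End RankMetric.

Theorem theorem4p15 (F : finFieldType) (n m : nat) (hn : (2 <= n)%N)
    (hnm : (n <= m)%N) (C : {vspace 'M[F]_(n, m)}) (k : nat)
    (hk : \dim C = k) (i : nat) (hi : (0 <= i <= k)%N) :
  BMD i C -> MRD i C.
Proof.
rewrite /BMD /MRD => bmd; have m_gt0 : (0 < m)%N by lia.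
have le_iC : (i <= \dim C)%N by rewrite hk.
have [[A [oA iA dimA]] _] := gen_rank_weightP hnm le_iC.
have le_d := gen_rank_weight_Singleton m_gt0 hnm le_iC.
have rA : max_rank A = gen_rank_weight C i.
  by apply/eqP; rewrite -(eqn_pmul2l m_gt0) -dimA eq_sym.
have sumAC : (A + C)%VS = fullv.
  apply/eqP/contraT => /exists_orthogonal_mx[N N_neq0 ACN].
  have NA := rank_orthogonal_anticode m_gt0 hnm oA
    (fun M MA => ACN M (subvP (addvSl A C) M MA)).
  have NC : N \in dual_code C.
    by apply/mem_dual_code => M MC; apply: ACN; apply: subvP (addvSr A C) M MC.
  (* [N] excludes the default distance [n.+1], so its rank is at least the dual distance, against
     [NA] and [bmd]. *)
  have dualC_neq0 : dual_code C != 0%VS.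
    by apply: contraNneq N_neq0 => dC0; rewrite -memv0 -dC0.
  have := (min_distanceP dualC_neq0).2 N NC N_neq0; lia.
have := dimv_sum_cap A C; rewrite sumAC dimv_fullmx dimA => dims.
(* By [dims] and [iA], [m * (n - gen_rank_weight C i)] equals [\dim C - \dim (A :&: C)], at most
   [\dim C - i]. *)
have le_n : (n - gen_rank_weight C i <= (\dim C - i) %/ m)%N.
  by rewrite leq_divRL // mulnBl; lia.
(* This makes the truncated difference in [le_d] agree with the integer one in the goal. *)
have le_kn : ((\dim C - i) %/ m <= n)%N.
  rewrite -[X in (_ <= X)%N](mulnK n m_gt0) leq_div2r // (leq_trans (leq_subr _ _)) //.
  by rewrite -(dimv_fullmx F) dimvS ?subvf.
by move: (gen_rank_weight C i) (_ %/ m)%N le_d le_n le_kn => d fl; lia.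
Qed.
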